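(* Let $f(x)=\mathbb{E}_{\xi\sim\mathcal{D}}[f_\xi(x)]$ satisfy the bounded variance assumption with constant $\sigma\ge0$ and the Hessian similarity assumption with constant $\delta\ge0$. Let $x_k$ be the iterates of SPAM with constant stepsize $\gamma_k=\gamma>0$ and constant momentum parameter $p_k=p\in(0,1]$, where $\gamma^2\le\min\left\{\frac{1}{16\delta^2},\frac{p}{96\delta^2(1-p)}\right\}$. Then for every $K\ge1$ $$\frac1K\sum_{k=1}^{K}\mathbb{E}\left[\|\nabla f(x_k)\|^2\right]\le\frac{32(f(x_0)-f_{\inf})}{\gamma K}+\frac{32\|g_0-\nabla f(x_0)\|^2}{(2p-p^2)K}+64p\sigma^2 .$$
   Context: Setting. $\mathcal{D}$ is a probability distribution over clients $\xi$; each $f_\xi:\mathbb{R}^d\to\mathbb{R}$ is differentiable and possibly non-convex; $f(x)=\mathbb{E}_{\xi\sim\mathcal{D}}[f_\xi(x)]$, and gradient and expectation are interchangeable: $\mathbb{E}_{\xi\sim\mathcal{D}}[\nabla f_\xi(x)]=\nabla f(x)$. The function $f$ is bounded below by $f_{\inf}>-\infty$. $\|\cdot\|$ is the Euclidean norm. Bounded variance: for all $x\in\mathbb{R}^d$, $\mathbb{E}_{\xi\sim\mathcal D}\left[\|\nabla f_\xi(x)-\nabla f(x)\|^2\right]\le\sigma^2$. Hessian similarity: for every $\xi$ and all $x,y\in\mathbb{R}^d$, $\|\nabla f_\xi(x)-\nabla f(x)-\nabla f_\xi(y)+\nabla f(y)\|\le\delta\|x-y\|$. SPAM algorithm: given $x_0\in\mathbb{R}^d$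 and an initial estimator $g_0$, at each iteration $k=0,1,2,\dots$ a client $\xi_k\sim\mathcal{D}$ is sampled (independently of the past); for $k\ge1$ one sets $g_k=\nabla f_{\xi_k}(x_k)+(1-p_k)\left(g_{k-1}-\nabla f_{\xi_k}(x_{k-1})\right)$; then $x_{k+1}=\mathrm{prox}_{\gamma_k f_{\xi_k}}\left(x_k+\gamma_k(\nabla f_{\xi_k}(x_k)-g_k)\right)$, where $\mathrm{prox}_g(x)=\arg\min_y\{g(y)+\frac12\|x-y\|^2\}$; equivalently $x_{k+1}$ is a minimizer over $y\in\mathbb{R}^d$ of $f_{\xi_k}(y)+\langle g_k-\nabla f_{\xi_k}(x_k),y-x_k\rangle+\frac{1}{2\gamma_k}\|y-x_k\|^2$. Convention: a fraction with positive numerator and zero denominator in the stepsize bound is read as $+\infty$. *)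

(* Defs.v *)
From HB Require Import structures.
From mathcomp Require Import all_boot all_order all_algebra.
From mathcomp Require Import all_classical all_reals all_analysis.

Set Implicit Arguments.
Unset Strict Implicit.
Unset Printing Implicit Defensive.

Import Order.TTheory GRing.Theory Num.Theory.
Import numFieldNormedType.Exports.

Local Open Scope classical_set_scope.
Local Open Scope ring_scope.

(* The library norm on row vectors is the sup norm, which induces the same
   topology and hence the same [differentiable], but is not the norm of the
   estimates. *)
Definition enorm (R : realType) (d : nat) (v : 'rV[R]_d) : R :=
  Num.sqrt (\sum_(i < d) v ord0 i ^+ 2).

Definition grad (R : realType) (d : nat) (f : 'rV[R]_d -> R) (x : 'rV[R]_d) :
    'rV[R]_d :=
  \row_(i < d) 'D_(delta_mx ord0 i) f x.

(* The set of minimizers: without convexity it need not be a singleton. *)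
Definition prox (R : realType) (d : nat) (h : 'rV[R]_d -> R) (x : 'rV[R]_d) :
    set 'rV[R]_d :=
  [set y | forall z, h y + 2^-1 * enorm (x - y) ^+ 2
                     <= h z + 2^-1 * enorm (x - z) ^+ 2].

Definition objective (R : realType) (disp : measure_display)
    (Xi : measurableType disp) (D : probability Xi R) (d : nat)
    (F : Xi -> 'rV[R]_d -> R) (x : 'rV[R]_d) : R :=
  fine 'E_D[fun xi => F xi x]%E.

(* The integrability clauses state that the two expectations exist. *)
Record smooth_objective (R : realType) (disp : measure_display)
    (Xi : measurableType disp) (D : probability Xi R) (d : nat)
    (F : Xi -> 'rV[R]_d -> R) : Prop := SmoothObjective {
  client_differentiable : forall xi x, differentiable (F xi) x ;
  client_integrable :
    forall x, D.-integrable setT (EFin \o (fun xi => F xi x)) ;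
  objective_differentiable : forall x, differentiable (objective D F) x ;
  client_grad_integrable :
    forall x (i : 'I_d),
      D.-integrable setT (EFin \o (fun xi => grad (F xi) x ord0 i)) ;
  grad_expectation :
    forall x (i : 'I_d),
      'E_D[fun xi => grad (F xi) x ord0 i]%E
      = (grad (objective D F) x ord0 i)%:E }.

Definition bounded_variance (R : realType) (disp : measure_display)
    (Xi : measurableType disp) (D : probability Xi R) (d : nat)
    (F : Xi -> 'rV[R]_d -> R) (sigma : R) : Prop :=
  forall x,
    ('E_D[fun xi => (enorm (grad (F xi) x - grad (objective D F) x) ^+ 2)%R]
     <= (sigma ^+ 2)%:E)%E.

Definition hessian_similarity (R : realType) (disp : measure_display)
    (Xi : measurableType disp) (D : probability Xi R) (d : nat)
    (F : Xi -> 'rV[R]_d -> R) (delta : R) : Prop :=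
  let f := objective D F in
  forall xi x y,
    enorm (grad (F xi) x - grad f x - grad (F xi) y + grad f y)
    <= delta * enorm (x - y).

Definition random_vector (R : realType) (disp : measure_display)
    (T : measurableType disp) (d : nat) (X : T -> 'rV[R]_d) : Prop :=
  forall i : 'I_d, measurable_fun setT (fun w => X w ord0 i).

(* The sigma-algebra of what is known just before the k-th client is drawn:
   the clients xi_j and estimators g_j for j < k, and the iterates x_j for
   j <= k (x_k is computed from xi_(k-1)). *)
Definition history (R : realType) (dispO disp : measure_display)
    (Omega : measurableType dispO) (Xi : measurableType disp) (d : nat)
    (xi : nat -> Omega -> Xi) (x g : nat -> Omega -> 'rV[R]_d) (k : nat) :
    set (set Omega) :=
  <<s [set A | exists j B,
         [/\ (j < k)%N, measurable B & A = xi j @^-1` B]]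
      `|` [set A | exists j (i : 'I_d) B,
         [/\ (j <= k)%N, measurable B & A = (fun w => x j w ord0 i) @^-1` B]]
      `|` [set A | exists j (i : 'I_d) B,
         [/\ (j < k)%N, measurable B & A = (fun w => g j w ord0 i) @^-1` B]] >>.

(* Since the minimizer defining x_(k+1) may fail to be unique, its measurability
   and the independence of xi_k from x_k are part of the definition. *)
Record SPAM (R : realType) (dispO disp : measure_display)
    (Omega : measurableType dispO) (P : probability Omega R)
    (Xi : measurableType disp) (D : probability Xi R) (d : nat)
    (F : Xi -> 'rV[R]_d -> R) (gamma p : nat -> R) (x0 g0 : 'rV[R]_d)
    (xi : nat -> {RV P >-> Xi}) (x g : nat -> Omega -> 'rV[R]_d) : Prop :=
  MkSPAM {
  spam_x_random : forall k, random_vector (x k) ;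
  spam_g_random : forall k, random_vector (g k) ;
  spam_client_law :
    forall k B, measurable B -> distribution P (xi k) B = D B ;
  spam_client_indep :
    forall k A B,
      history (fun j => xi j : Omega -> Xi) x g k A -> measurable B ->
      P (A `&` xi k @^-1` B) = (P A * P (xi k @^-1` B))%E ;
  spam_x0 : forall w, x 0%N w = x0 ;
  spam_g0 : forall w, g 0%N w = g0 ;
  spam_gS :
    forall k w,
      g k.+1 w = grad (F (xi k.+1 w)) (x k.+1 w)
                 + (1 - p k.+1) *: (g k w - grad (F (xi k.+1 w)) (x k w)) ;
  spam_xS :
    forall k w,
      prox (fun y => gamma k * F (xi k w) y)
           (x k w + gamma k *: (grad (F (xi k w)) (x k w) - g k w))
           (x k.+1 w) }.

(* Main.v *)
Require Import Defs.
From HB Require Import structures.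
From mathcomp Require Import all_boot all_order all_algebra.
From mathcomp Require Import all_classical all_reals all_analysis.
From mathcomp Require Import measurable_realfun ring lra.

Set Implicit Arguments.
Unset Strict Implicit.
Unset Printing Implicit Defensive.

Import Order.TTheory GRing.Theory Num.Theory.
Import numFieldNormedType.Exports.

Local Open Scope classical_set_scope.
Local Open Scope ring_scope.

(** Write [f] for the objective, [h_xi = grad f_xi - grad f] for the deviation of
    a client, [e_k = g_k - grad f (x_k)] for the estimation error and
    [s_k = x_(k+1) - x_k] for the step. By similarity [h_xi] is
    [delta]-Lipschitz, and [h_xi y] has mean zero and second moment at most
    [sigma ^ 2] at every fixed point [y].

    A proximal step on [f_xi] satisfies two deterministic estimates. Comparing
    the minimizer with [x_k] and applying the descent lemma to [f - f_xi], whose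
    gradient [- h_xi] is [delta]-Lipschitz, gives ([prox_descent])
      [f (x_(k+1)) + |s_k|^2 / (6 gamma) <= f (x_k) + (6/5) gamma |e_k|^2],
    and the first-order optimality condition gives ([prox_grad_le])
      [|grad f (x_(k+1))|^2 <= 2 |e_k|^2 + 25 / (8 gamma^2) |s_k|^2].
    Of the stepsize condition, both use only [gamma delta <= 1/4].

    The error obeys
      [e_(k+1) = (1 - p) e_k + h_xi (x_(k+1)) - (1 - p) h_xi (x_k)]
    with [xi = xi_(k+1)] independent of [e_k], [x_k] and [x_(k+1)]. Given the
    past, the last two terms have mean zero, so the cross term vanishes, and
    writing them as [p h_xi (x_(k+1)) + (1 - p) (h_xi (x_(k+1)) - h_xi (x_k))]
    bounds their second moment ([grad_error_recursion]):
      [E|e_(k+1)|^2 <= (1-p)^2 E|e_k|^2 + 2 p^2 sigma^2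
                       + 2 (1-p)^2 delta^2 E|s_k|^2].
    Summing the three recursions and eliminating the sums of [E|e_k|^2] and
    [E|s_k|^2] gives the theorem ([recursion_bound]).

    Conditioning on the past is done with Tonelli's theorem alone: the identity
    of the sample space, seen as a random variable with values in the same space
    with the sigma-algebra of the past, is independent of [xi_(k+1)], so the
    joint law is a product measure ([ge0_le_integral_indep]). The
    deviation [h_xi y] is jointly measurable because it is measurable in [xi] and
    continuous in [y], hence a limit of its values on finer and finer countable
    grids ([measurable_caratheodory]). All second moments are finite by induction
    ([moments_fin]), which allows passing to real numbers. *)

(** * Euclidean geometry of row vectors *)

(** The standard inner product; [enorm v ^+ 2 = dot v v]. *)
Definition dot (R : realType) (d : nat) (u v : 'rV[R]_d) : R :=
  \sum_(i < d) u ord0 i * v ord0 i.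

Section euclidean.
Context {R : realType} {d : nat}.
Implicit Types (u v w : 'rV[R]_d) (c : R).

Lemma enorm_sqr v : enorm v ^+ 2 = \sum_(i < d) v ord0 i ^+ 2.
Proof. by rewrite /enorm sqr_sqrtr// sumr_ge0// => i _; rewrite sqr_ge0. Qed.

Lemma enorm_sqrE v : enorm v ^+ 2 = dot v v.
Proof. by rewrite enorm_sqr; apply: eq_bigr => i _; rewrite expr2. Qed.

Lemma enorm_ge0 v : 0 <= enorm v.
Proof. exact: sqrtr_ge0. Qed.

Lemma dotC u v : dot u v = dot v u.
Proof. by apply: eq_bigr => i _; rewrite mulrC. Qed.

Lemma dotDl u v w : dot (u + v) w = dot u w + dot v w.
Proof. by rewrite -big_split; apply: eq_bigr => i _; rewrite mxE mulrDl. Qed.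

Lemma dotZl c u w : dot (c *: u) w = c * dot u w.
Proof. by rewrite mulr_sumr; apply: eq_bigr => i _; rewrite mxE mulrA. Qed.

Lemma dotNl u w : dot (- u) w = - dot u w.
Proof. by rewrite -scaleN1r dotZl mulN1r. Qed.

Lemma dotDr u v w : dot w (u + v) = dot w u + dot w v.
Proof. by rewrite dotC dotDl !(dotC w). Qed.

Lemma dotZr c u w : dot w (c *: u) = c * dot w u.
Proof. by rewrite dotC dotZl (dotC w). Qed.

Lemma dotNr u w : dot w (- u) = - dot w u.
Proof. by rewrite dotC dotNl (dotC w). Qed.

Definition dotE := (dotDl, dotDr, dotNl, dotNr, dotZl, dotZr).

Lemma enorm_sqrD u v :
  enorm (u + v) ^+ 2 = enorm u ^+ 2 + 2 * dot u v + enorm v ^+ 2.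
Proof. by rewrite !enorm_sqrE !dotE (dotC v u); ring. Qed.

Lemma enormN v : enorm (- v) = enorm v.
Proof. by congr Num.sqrt; apply: eq_bigr => i _; rewrite mxE sqrrN. Qed.

Lemma enorm_sqrZ c v : enorm (c *: v) ^+ 2 = c ^+ 2 * enorm v ^+ 2.
Proof. by rewrite !enorm_sqrE !dotE; ring. Qed.

Lemma enormZ c v : enorm (c *: v) = `|c| * enorm v.
Proof.
have := congr1 Num.sqrt (enorm_sqrZ c v).
by rewrite -exprMn !sqrtr_sqr normrM !(ger0_norm (enorm_ge0 _)).
Qed.

Lemma enorm_sqr_eq0 v : enorm v ^+ 2 = 0 -> v = 0.
Proof.
rewrite enorm_sqr => /eqP; rewrite psumr_eq0 => [/allP v0|i _]; last first.
  exact: sqr_ge0.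
apply/rowP => i; rewrite mxE; apply/eqP.
by have := v0 i (mem_index_enum i); rewrite sqrf_eq0.
Qed.

(** Cauchy-Schwarz inequality. *)
Lemma dot_le_enorm u v : dot u v <= enorm u * enorm v.
Proof.
have [uv0|uv0] := leP (enorm u * enorm v) 0.
  have /eqP : enorm u * enorm v = 0.
    by apply/eqP; rewrite eq_le uv0 mulr_ge0// enorm_ge0.
  rewrite mulf_eq0 => /orP[] /eqP n0; rewrite n0 ?(mul0r, mulr0).
    by rewrite (@enorm_sqr_eq0 u) ?n0 ?expr0n// -(scale0r 0) dotZl !mul0r.
  by rewrite (@enorm_sqr_eq0 v) ?n0 ?expr0n// -(scale0r 0) dotZr mul0r.
have := sqr_ge0 (enorm (enorm v *: u - enorm u *: v)).
rewrite enorm_sqrE !dotE -!enorm_sqrE (dotC v u).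
by move=> h; rewrite -subr_ge0 -(pmulr_rge0 _ uv0); lra.
Qed.

(** Weighted Young inequality. *)
Lemma enorm_sqrD_le c u v : 0 < c ->
  enorm (u + v) ^+ 2 <= (1 + c) * enorm u ^+ 2 + (1 + c^-1) * enorm v ^+ 2.
Proof.
move=> c0; have h := sqr_ge0 (enorm (c *: u - v)).
rewrite enorm_sqrD enormN enorm_sqrZ dotZl dotNr in h.
rewrite enorm_sqrD.
have c'0 : 0 <= c^-1 by rewrite invr_ge0 ltW.
have {h} := mulr_ge0 c'0 h.
rewrite (_ : c^-1 * _ = c * enorm u ^+ 2 - 2 * dot u v + c^-1 * enorm v ^+ 2).
  lra.
by field; rewrite gt_eqF.
Qed.

Lemma enorm_sqrD_le2 u v :
  enorm (u + v) ^+ 2 <= 2 * enorm u ^+ 2 + 2 * enorm v ^+ 2.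
Proof. by have := enorm_sqrD_le u v (@ltr01 R); rewrite invr1. Qed.

Lemma normr_le_enorm v (i : 'I_d) : `|v ord0 i| <= enorm v.
Proof.
rewrite -sqrtr_sqr /enorm ler_sqrt; last by apply: sumr_ge0 => j _; apply: sqr_ge0.
by rewrite (bigD1 i)//= lerDl sumr_ge0// => j _; rewrite sqr_ge0.
Qed.

End euclidean.

(** * Gradients and proximal points *)

Section gradients.
Context {R : realType} {d : nat}.
Implicit Types (f q : 'rV[R]_d -> R) (x y v : 'rV[R]_d).

Lemma derive_grad f x v : differentiable f x -> 'D_v f x = dot (grad f x) v.
Proof.
move=> df; rewrite deriveE// [X in 'd f x X]row_sum_delta linear_sum.
apply: eq_bigr => i _; rewrite linearZ /= mxE deriveE// mulrC.
by [].
Qed.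

Lemma gradB f q x : differentiable f x -> differentiable q x ->
  grad (f \- q) x = grad f x - grad q x.
Proof.
move=> df dq; apply/rowP => i; rewrite !mxE deriveB//; exact: diff_derivable.
Qed.

Lemma is_derive_line f x v (t : R) : differentiable f (x + t *: v) ->
  is_derive t 1 (fun s : R => f (x + s *: v)) (dot (grad f (x + t *: v)) v).
Proof.
move=> df; rewrite -derive_grad//.
have E : (fun h : R => h^-1 *: (((fun s : R => f (x + s *: v)) \o shift t) (h *: 1)
                              - f (x + t *: v)))
       = (fun h : R => h^-1 *: ((f \o shift (x + t *: v)) (h *: v)
                              - f (x + t *: v))).
  apply/funext => h /=; rewrite [h *: 1]mulr1 scalerDl.
  by rewrite addrCA.
have := @diff_derivable _ _ _ f (x + t *: v) v df; rewrite /derivable -E => dg.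
by apply: DeriveDef => //; rewrite /derive E.
Qed.

Lemma is_derive_quad (G : R -> R) (c b e t a : R) : is_derive t 1 G a ->
  is_derive t 1 (fun s => c * G s - s * b + e * s ^+ 2) (c * a - b + 2 * e * t).
Proof.
move=> dG.
have -> : (fun s => c * G s - s * b + e * s ^+ 2)
        = c \*: G - b \*: id + e \*: (id * id : R -> R).
  by apply/funext => s; rewrite !fctE /= /GRing.scale /= expr2; ring.
apply: is_derive_eq; rewrite /GRing.scale /=; ring.
Qed.

(** The hypothesis is the one-sided form of Lipschitz continuity of the gradient
    along the ray from [x]; a Lipschitz constant [l] gives [L = l |v|^2]. *)
Lemma descent_lemma q x v (L : R) : (forall y, differentiable q y) ->
  (forall t, 0 <= t -> dot (grad q (x + t *: v) - grad q x) v <= L * t) ->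
  q (x + v) <= q x + dot (grad q x) v + L / 2.
Proof.
move=> dq hL.
(* By hypothesis the derivative of u is nonpositive on [0, 1]. *)
pose u (t : R) := q (x + t *: v) - t * dot (grad q x) v - L / 2 * t ^+ 2.
have du (t : R) : is_derive t 1 u
    (dot (grad q (x + t *: v)) v - dot (grad q x) v - L * t).
  have -> : u = fun s => 1 * q (x + s *: v) - s * dot (grad q x) v
                         + - (L / 2) * s ^+ 2.
    by apply/funext => s; rewrite /u; ring.
  apply: is_derive_eq.
    exact/is_derive_quad/is_derive_line/dq.
  by field.
have [|t t01] := @MVT R u _ 0 1 ltr01 (fun t _ => du t).
  apply: continuous_subspaceT => t.
  by apply: differentiable_continuous; apply/derivable1_diffP.
rewrite /u scale1r scale0r addr0 => e.
have := hL t; rewrite dotDl dotNl => /(_ _) h.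
have {}h : dot (grad q (x + t *: v)) v - dot (grad q x) v <= L * t.
  by apply: h; move: t01; rewrite in_itv /= => /andP[/ltW].
move: e; lra.
Qed.

(** First-order optimality for a proximal step: the objective restricted to the
    line through [y] directed by [v = c grad f y - (z - y)] has a minimum at [y],
    with derivative [|v|^2] there. *)
Lemma prox_grad0 f (c : R) z y : (forall y, differentiable f y) ->
  prox (fun y => c * f y) z y -> c *: grad f y = z - y.
Proof.
move=> df ymin; apply/eqP; rewrite -subr_eq0; apply/eqP.
set v := _ - _; apply: enorm_sqr_eq0.
(* u is the objective along the line, up to an additive constant. *)
pose u (t : R) := c * f (y + t *: v) - t * dot (z - y) v
                  + 2^-1 * enorm v ^+ 2 * t ^+ 2.
have uE t : u t = c * f (y + t *: v) + 2^-1 * enorm (z - (y + t *: v)) ^+ 2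
                  - 2^-1 * enorm (z - y) ^+ 2.
  by rewrite /u opprD addrA (enorm_sqrD (z - y)) enormN enorm_sqrZ dotNr dotZr;
    field.
have du : is_derive (0 : R) (1 : R) u (c * dot (grad f y) v - dot (z - y) v).
  have := is_derive_quad c (dot (z - y) v) (2^-1 * enorm v ^+ 2)
            (is_derive_line (df (y + 0 *: v))).
  by rewrite mulr0 addr0 scale0r addr0.
have u0 : is_derive (0 : R) (1 : R) u 0.
  apply: (@derive1_at_min _ u (-1) 1) => //.
  - move=> t _.
    by case: (is_derive_quad c (dot (z - y) v) (2^-1 * enorm v ^+ 2)
      (is_derive_line (df (y + t *: v)))) => du1 _.
  - by rewrite in_itv /= ltrN10 ltr01.
  - move=> t _; rewrite !uE scale0r addr0.
    by have := ymin (y + t *: v); rewrite /=; lra.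
have : c * dot (grad f y) v - dot (z - y) v = 0.
  by rewrite -(@derive_val _ _ _ _ _ _ _ du) (@derive_val _ _ _ _ _ _ _ u0).
by rewrite enorm_sqrE -dotZl -dotNl -dotDl.
Qed.

End gradients.

(** * Measurability of functions of random vectors *)

Section caratheodory.
Context {R : realType} {d : nat}.
Implicit Types (x y : 'rV[R]_d) (n : nat) (v : 'rV[int]_d).

(** [grid_point n (grid_index n x)] is [x] with its coordinates rounded down to
    multiples of [1 / (n + 1)]. The index is an integer vector, and these form a
    countable type. *)
Definition grid_index n x : 'rV[int]_d :=
  \row_i Num.floor (x ord0 i * n.+1%:R).

Definition grid_point n v : 'rV[R]_d := \row_i ((v ord0 i)%:~R / n.+1%:R).

Lemma grid_dist n x (i : 'I_d) :
  `|x ord0 i - grid_point n (grid_index n x) ord0 i| <= n.+1%:R^-1.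
Proof.
rewrite !mxE; set a := x ord0 i; set N : R := n.+1%:R.
have N0 : 0 < N by rewrite ltr0n.
have /andP[h1 h2] := floor_itv (a * N).
have -> : a - (Num.floor (a * N))%:~R / N
          = (a * N - (Num.floor (a * N))%:~R) / N.
  by field; rewrite gt_eqF.
rewrite ger0_norm; last by rewrite divr_ge0 ?subr_ge0 ?(ltW N0).
rewrite -[X in _ <= X]mul1r ler_pM2r ?invr_gt0// lerBlDl.
by move: h2; rewrite intrD => /ltW.
Qed.

Lemma grid_cvg x : grid_point n (grid_index n x) @[n --> \oo] --> x.
Proof.
apply/cvg_ballP => e e0.
have : \forall n \near \oo, `|n.+1%:R^-1 : R| < e.
  have /cvgrPdist_lt/(_ _ e0) := @cvg_harmonic R.
  by apply: filterS => n; rewrite sub0r normrN.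
apply: filterS => n ne; split => // i j.
rewrite /ball /= (ord1 i); apply: le_lt_trans (grid_dist _ _ _) _.
by apply: le_lt_trans ne; rewrite ler_norm.
Qed.

Lemma measurable_grid_index disp (S : measurableType disp)
    (X : S -> 'rV[R]_d) n v : random_vector X ->
  measurable ((fun s => grid_index n (X s)) @^-1` [set v]).
Proof.
move=> mX.
have -> : (fun s => grid_index n (X s)) @^-1` [set v] =
  \bigcap_(i in [set: 'I_d]) ((fun s => X s ord0 i * n.+1%:R) @^-1`
     `[(v ord0 i)%:~R, (v ord0 i + 1)%:~R[).
  apply/seteqP; split => s /=.
    by move=> <- i _ /=; rewrite in_itv /= mxE floor_itv.
  move=> h; apply/rowP => i; rewrite mxE; apply: floor_def.
  by have := h i I; rewrite /= in_itv.
apply: fin_bigcap_measurable; first exact: finite_finset.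
move=> i _; rewrite -[X in measurable X]setTI.
suff : measurable_fun setT (fun s => X s ord0 i * n.+1%:R) by apply.
by apply: measurable_funM => //; exact: mX.
Qed.

(** A function measurable in its first variable and continuous in the second
    (a Caratheodory function) stays measurable when a random vector is
    substituted for the second. *)
Lemma measurable_caratheodory disp (S : measurableType disp)
    (G : S -> 'rV[R]_d -> R) (X : S -> 'rV[R]_d) :
  (forall y, measurable_fun setT (G ^~ y)) ->
  (forall s, continuous (G s)) -> random_vector X ->
  measurable_fun setT (fun s => G s (X s)).
Proof.
move=> mG cG mX.
apply: (@measurable_fun_cvg _ _ _ _
    (fun n s => G s (grid_point n (grid_index n (X s))))); last first.
  by move=> s _; apply: continuous_cvg; [exact: cG | exact: grid_cvg].
move=> n _ B mB; rewrite setTI.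
have -> : (fun s => G s (grid_point n (grid_index n (X s)))) @^-1` B
  = \bigcup_(v : 'rV[int]_d) ((fun s => grid_index n (X s)) @^-1` [set v]
       `&` (G ^~ (grid_point n v)) @^-1` B).
  apply/seteqP; split => s /=.
    by move=> sB; exists (grid_index n (X s)).
  by move=> [v _ [/= <-]].
apply: countable_bigcupT_measurable => [|v]; first exact: countableP.
apply: measurableI; first exact: measurable_grid_index.
by rewrite -[X in measurable X]setTI; exact: mG.
Qed.

Lemma measurable_continuous_comp disp (S : measurableType disp)
    (q : 'rV[R]_d -> R) (X : S -> 'rV[R]_d) :
  continuous q -> random_vector X -> measurable_fun setT (fun s => q (X s)).
Proof. by move=> cq mX; apply: (@measurable_caratheodory _ _ (fun=> q)). Qed.

(** The gradient of a differentiable function need not be continuous, but it is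
    a limit of continuous difference quotients. *)
Lemma random_vector_grad disp (S : measurableType disp)
    (q : 'rV[R]_d -> R) (X : S -> 'rV[R]_d) :
  (forall y, differentiable q y) -> random_vector X ->
  random_vector (fun s => grad q (X s)).
Proof.
move=> dq mX i.
pose h n : R := n.+1%:R^-1.
have h0 n : h n != 0 by rewrite invr_neq0// pnatr_eq0.
have hcvg : h n @[n --> \oo] --> 0^'.
  move=> A A0; have hA := @cvg_harmonic R _ A0.
  have {}hA : \forall n \near \oo, h n != 0 -> A (h n) by exact: hA.
  by apply: filterS hA => n; apply; exact: h0.
apply: (@measurable_fun_cvg _ _ _ _ (fun n s =>
   (h n)^-1 * (q (h n *: delta_mx ord0 i + X s) - q (X s)))).
  move=> n; apply: measurable_funM => //.
  apply: measurable_funB; last first.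
    apply: measurable_continuous_comp => // y.
    exact: differentiable_continuous.
  apply: (@measurable_continuous_comp _ _
    (fun y => q (h n *: delta_mx ord0 i + y))) => // y.
  apply: (@continuous_comp _ _ _ (fun y => h n *: delta_mx ord0 i + y) q y).
    by apply: (@cvgD _ _ _ (nbhs y) _ (cst (h n *: delta_mx ord0 i)) idfun);
      [exact: cvg_cst | exact: cvg_id].
  exact: differentiable_continuous.
move=> s _; rewrite mxE.
have : derivable q (X s) (delta_mx ord0 i) by exact: diff_derivable.
rewrite /derivable => dq'; have := cvg_comp _ _ hcvg dq'; apply.
Qed.

End caratheodory.

Lemma random_vector_comp (R : realType) (d1 d2 : measure_display)
    (S : measurableType d1) (T : measurableType d2) (d : nat)
    (phi : S -> T) (X : T -> 'rV[R]_d) :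
  measurable_fun setT phi -> random_vector X -> random_vector (X \o phi).
Proof. by move=> mphi mX i; exact: measurableT_comp (mX i) mphi. Qed.

Lemma measurable_dot (R : realType) (disp : measure_display)
    (S : measurableType disp) (d : nat) (X Y : S -> 'rV[R]_d) :
  random_vector X -> random_vector Y ->
  measurable_fun setT (fun s => dot (X s) (Y s)).
Proof.
by move=> mX mY; apply: measurable_sum => i; apply: measurable_funM;
  [exact: mX | exact: mY].
Qed.

Lemma measurable_enorm_sqr (R : realType) (disp : measure_display)
    (S : measurableType disp) (d : nat) (X : S -> 'rV[R]_d) :
  random_vector X -> measurable_fun setT (fun s => enorm (X s) ^+ 2).
Proof.
move=> mX; apply: eq_measurable_fun (measurable_dot mX mX) => s _.
by rewrite enorm_sqrE.
Qed.

Lemma random_vectorD (R : realType) (disp : measure_display)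
    (S : measurableType disp) (d : nat) (X Y : S -> 'rV[R]_d) :
  random_vector X -> random_vector Y -> random_vector (fun s => X s + Y s).
Proof.
move=> mX mY i; apply: eq_measurable_fun (measurable_funD (mX i) (mY i)).
by move=> s _; rewrite mxE.
Qed.

Lemma random_vectorZ (R : realType) (disp : measure_display)
    (S : measurableType disp) (d : nat) (c : R) (X : S -> 'rV[R]_d) :
  random_vector X -> random_vector (fun s => c *: X s).
Proof.
move=> mX i; apply: eq_measurable_fun (measurable_funM (measurable_cst c) (mX i)).
by move=> s _; rewrite mxE.
Qed.

Lemma random_vectorB (R : realType) (disp : measure_display)
    (S : measurableType disp) (d : nat) (X Y : S -> 'rV[R]_d) :
  random_vector X -> random_vector Y -> random_vector (fun s => X s - Y s).
Proof.
move=> mX mY; have := random_vectorD mX (random_vectorZ (-1) mY).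
by congr random_vector; apply/funext => s; rewrite scaleN1r.
Qed.

(** * Deterministic estimates for one proximal step *)

Section one_step.
Context {R : realType} {d : nat}.
Variables (q f : 'rV[R]_d -> R) (delta gamma : R) (g x y : 'rV[R]_d).
Hypothesis dq : forall z, differentiable q z.
Hypothesis df : forall z, differentiable f z.
Hypothesis delta_ge0 : 0 <= delta.
Hypothesis similar : forall z z',
  enorm (grad q z - grad f z - grad q z' + grad f z') <= delta * enorm (z - z').
Hypothesis gamma_gt0 : 0 < gamma.
Hypothesis gamma_le : 16 * delta ^+ 2 * gamma ^+ 2 <= 1.
Hypothesis y_prox :
  prox (fun z => gamma * q z) (x + gamma *: (grad q x - g)) y.

(** The gradients of [q] and [f] need not be Lipschitz, only that of their
    difference: the terms in [q] cancel between the minimality of [y] and the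
    descent lemma for [f - q]. *)
Lemma prox_descent : f y + (6 * gamma)^-1 * enorm (y - x) ^+ 2
  <= f x + 6 / 5 * gamma * enorm (g - grad f x) ^+ 2.
Proof.
have gd : gamma * delta <= 4^-1.
  have h : (gamma * delta) ^+ 2 <= 4^-1 ^+ 2 by move: gamma_le; lra.
  by rewrite -(@ler_pXn2r _ 2)// nnegrE ?invr_ge0// mulr_ge0// ltW.
set v := y - x; set e := g - grad f x.
have xv : x + v = y by rewrite /v addrC subrK.
(* The minimality of y, compared with the competitor x. *)
have opt : gamma * q y <= gamma * q x - 2^-1 * enorm v ^+ 2
                          + gamma * dot (grad q x - g) v.
  have := y_prox x; rewrite -[in _ - y]xv opprD addrACA subrr add0r.
  rewrite [x + _ - x]addrAC subrr add0r (enorm_sqrD (_ *: _)) enormN dotZl dotNr.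
  by lra.
have smooth : (f \- q) y <= (f \- q) x + dot (grad f x - grad q x) v
                            + delta * enorm v ^+ 2 / 2.
  have dfq z : differentiable (f \- q) z by exact: differentiableB.
  have gfq z : grad (f \- q) z = grad f z - grad q z by exact: gradB.
  rewrite -xv -gfq; apply: descent_lemma => // t t0.
  apply: le_trans (dot_le_enorm _ _) _.
  have := similar x (x + t *: v).
  rewrite opprD addrA subrr add0r enormN.
  have -> : enorm (t *: v) = t * enorm v.
    by rewrite enormZ ger0_norm.
  have -> : grad q x - grad f x - grad q (x + t *: v) + grad f (x + t *: v)
     = grad (f \- q) (x + t *: v) - grad (f \- q) x.
    by rewrite !gfq; apply/rowP => i; rewrite !mxE; ring.
  move=> h; have := ler_wpM2r (enorm_ge0 v) h; lra.
(* Young's inequality splits the error term [- gamma * dot e v]; the weight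
   leaves 1/2 - 1/8 - 5/24 = 1/6 for the square of the step. *)
have young := sqr_ge0 (enorm ((12 / 5 * gamma) *: e + v)).
rewrite enorm_sqrD enorm_sqrZ dotZl in young.
have gv : dot (grad q x - g) v + dot (grad f x - grad q x) v = - dot e v.
  by rewrite -dotDl -dotNl; congr dot; apply/rowP => i; rewrite !mxE; ring.
rewrite -(ler_pM2l gamma_gt0).
have -> : gamma * (f y + (6 * gamma)^-1 * enorm v ^+ 2)
        = gamma * f y + 6^-1 * enorm v ^+ 2.
  by field; rewrite gt_eqF.
have := ler_wpM2l (ltW gamma_gt0) smooth.
have := ler_wpM2r (sqr_ge0 (enorm v)) gd.
rewrite /=; move: gv opt young => gv.
have {gv} -> : dot (grad f x - grad q x) v = - dot e v - dot (grad q x - g) v.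
  by rewrite -gv; ring.
lra.
Qed.

(** By first-order optimality [grad f y] is the sum of [- (g - grad f x)], a
    difference of deviations of size [delta |y - x|], and [- (y - x) / gamma]. *)
Lemma prox_grad_le : enorm (grad f y) ^+ 2
  <= 2 * enorm (g - grad f x) ^+ 2 + 25 / (8 * gamma ^+ 2) * enorm (y - x) ^+ 2.
Proof.
have gK : gamma^-1 * gamma = 1 by rewrite mulVf ?gt_eqF.
have := prox_grad0 dq y_prox.
set u := grad q x - grad f x - grad q y + grad f y => opt.
have -> : grad f y = - (g - grad f x) + (u + - gamma^-1 *: (y - x)).
  have /(congr1 (fun w => gamma^-1 *: w)) := opt.
  rewrite scalerA gK scale1r => qy; rewrite /u qy.
  apply/rowP => i; rewrite !mxE; field.
  by rewrite gt_eqF.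
apply: le_trans (enorm_sqrD_le2 _ _) _; rewrite enormN lerD2l.
(* With gamma * delta <= 1/4, the weights 5 and 5/4 give 2 (5/16 + 5/4) = 25/8. *)
apply: le_trans (ler_wpM2l _ (enorm_sqrD_le (c := 4) _ _ _)) _ => //.
rewrite enorm_sqrZ sqrrN.
have hu : enorm u ^+ 2 <= delta ^+ 2 * enorm (y - x) ^+ 2.
  rewrite -[y - x]opprB enormN -exprMn.
  by rewrite ler_pXn2r ?nnegrE ?mulr_ge0 ?enorm_ge0//; exact: similar.
have hd : delta ^+ 2 <= (16 * gamma ^+ 2)^-1.
  rewrite -[X in _ <= X]mul1r ler_pdivlMr ?mulr_gt0 ?exprn_gt0//.
  by apply: le_trans gamma_le; lra.
have := ler_wpM2r (sqr_ge0 (enorm (y - x))) hd.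
move: hu; set n := enorm (y - x) ^+ 2.
have -> : (16 * gamma ^+ 2)^-1 = 16^-1 * gamma^-1 ^+ 2.
  by field; rewrite gt_eqF.
have -> : 25 / (8 * gamma ^+ 2) = 25 / 8 * gamma^-1 ^+ 2.
  by field; rewrite gt_eqF.
by lra.
Qed.

End one_step.

(** * Summation of the recursions *)

(** The summed recursions, in the sums [A] of [a] and [S] of [r] over [k < K]:
    by the condition on [p] the error recursion bounds [gamma A] by [gamma B]
    plus [S / (48 gamma)], where [B = a 0 / (2 p - p^2) + 2 p sigma^2 K], while
    the descent recursion bounds [S / (6 gamma)] by [phi 0 + (6/5) gamma A].
    Hence [A] is bounded, then [S], then the sum of [G]. *)
Lemma recursion_bound (R : realType) (phi a r G : nat -> R)
    (delta gamma p sigma : R) (K : nat) :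
  (forall k, 0 <= phi k) -> (forall k, 0 <= a k) -> (forall k, 0 <= r k) ->
  0 < gamma -> 0 < p <= 1 ->
  96 * delta ^+ 2 * (1 - p) * gamma ^+ 2 <= p ->
  (forall k, phi k.+1 + (6 * gamma)^-1 * r k <= phi k + 6 / 5 * gamma * a k) ->
  (forall k, a k.+1 <= (1 - p) ^+ 2 * a k + 2 * p ^+ 2 * sigma ^+ 2
                       + 2 * (1 - p) ^+ 2 * delta ^+ 2 * r k) ->
  (forall k, G k.+1 <= 2 * a k + 25 / (8 * gamma ^+ 2) * r k) ->
  (1 <= K)%N ->
  K%:R^-1 * \sum_(1 <= k < K.+1) G k
  <= 32 * phi 0%N / (gamma * K%:R) + 32 * a 0%N / ((2 * p - p ^+ 2) * K%:R)
     + 64 * p * sigma ^+ 2.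
Proof.
move=> phi0 a0 r0 g0 /andP[p0 p1] gp Hphi Ha HG K1.
pose A n := \sum_(k < n) a k; pose S n := \sum_(k < n) r k.
have A0 : 0 <= A K by exact: sumr_ge0.
have S0 : 0 <= S K by exact: sumr_ge0.
have sphi n : phi n + (6 * gamma)^-1 * S n <= phi 0%N + 6 / 5 * gamma * A n.
  elim: n => [|n IH]; first by rewrite /A /S !big_ord0 !mulr0.
  rewrite /A /S !big_ord_recr /= -/(A n) -/(S n).
  by have := Hphi n; lra.
have sa n : a n + (2 * p - p ^+ 2) * A n <= a 0%N
    + n%:R * (2 * p ^+ 2 * sigma ^+ 2) + 2 * (1 - p) ^+ 2 * delta ^+ 2 * S n.
  elim: n => [|n IH].
    by rewrite /A /S !big_ord0 !mulr0 mul0r !addr0.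
  rewrite /A /S !big_ord_recr /= -/(A n) -/(S n) -natr1.
  by have := Ha n; lra.
have sG : \sum_(1 <= k < K.+1) G k <= 2 * A K + 25 / (8 * gamma ^+ 2) * S K.
  rewrite big_add1 /= big_mkord /A /S !mulr_sumr -big_split /=.
  by apply: ler_sum => k _; exact: HG.
set T := \sum_(1 <= k < K.+1) G k in sG *.
have K0 : 0 < K%:R :> R by rewrite ltr0n.
have P0 : p <= 2 * p - p ^+ 2.
  by rewrite expr2; have := ler_wpM2l (ltW p0) p1; lra.
have P1 : 0 < 2 * p - p ^+ 2 by exact: lt_le_trans P0.
set c := 2 * p - p ^+ 2 in sa P0 P1 *.
set B := a 0%N / c + 2 * p * sigma ^+ 2 * K%:R.
have u0 : 0 <= 2 * p * sigma ^+ 2 * K%:R.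
  exact: mulr_ge0 (mulr_ge0 (mulr_ge0 (ler0n _ 2) (ltW p0)) (sqr_ge0 _)) (ltW K0).
have hA : gamma * A K <= gamma * B + (48 * gamma)^-1 * S K.
  rewrite -(ler_pM2r P1).
  have e1 : gamma * a 0%N = gamma * (a 0%N / c) * c by field; rewrite gt_eqF.
  (* The condition on p enters here. *)
  have e2 : 2 * (1 - p) ^+ 2 * delta ^+ 2 * gamma * S K
            <= (48 * gamma)^-1 * c * S K.
    apply: ler_wpM2r => //; rewrite -(ler_pM2r g0).
    have -> : (48 * gamma)^-1 * c * gamma = 48^-1 * c.
      by field; rewrite gt_eqF.
    have p1' : 0 <= 1 - p <= 1 by apply/andP; split; lra.
    have := ler_wpM2l (proj1 (andP p1')) gp.
    have : (1 - p) * p <= p by have := ler_wpM2r (ltW p0) (proj2 (andP p1')); lra.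
    by rewrite !expr2; move: P0; clear; lra.
  have e3 : gamma * (K%:R * (2 * p ^+ 2 * sigma ^+ 2))
            <= gamma * (2 * p * sigma ^+ 2 * K%:R) * c.
    have w0 := mulr_ge0 (ltW g0) u0.
    by have := ler_wpM2l w0 P0; move: (gamma) (sigma ^+ 2) (K%:R : R); clear=> *; lra.
  have := ler_wpM2l (ltW g0) (sa K); have := mulr_ge0 (ltW g0) (a0 K).
  rewrite /B; move: e1 e2 e3; clear; lra.
have hS : (6 * gamma)^-1 * S K <= phi 0%N + 6 / 5 * gamma * A K.
  by have := sphi K; have := phi0 K; lra.
have hB : 0 <= B.
  exact: addr_ge0 (divr_ge0 (a0 0%N) (ltW P1)) u0.
have main : gamma * T <= 32 * phi 0%N + 32 * (gamma * B).
  have := ler_wpM2l (ltW g0) sG.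
  rewrite (_ : gamma * (_ + _) = 2 * (gamma * A K) + 75 / 4 * ((6 * gamma)^-1 * S K));
    last by field; rewrite gt_eqF.
  have e : (48 * gamma)^-1 * S K = 8^-1 * ((6 * gamma)^-1 * S K).
    by field; rewrite gt_eqF.
  have := phi0 0%N; have := mulr_ge0 (ltW g0) hB.
  move: hA hS; rewrite e.
  by move: (gamma * T) => gT; clear; lra.
rewrite -(ler_pM2l K0) mulVKf ?gt_eqF// -(ler_pM2l g0).
rewrite (_ : _ * (_ * (_ + _)) = 32 * phi 0%N + 32 * (gamma * B)) //.
by rewrite /B; field; rewrite !gt_eqF.
Qed.

(** * Expectations of nonnegative variables and independence *)

(** The expectation as an integral, also for functions not known to be
    measurable. *)
Lemma expectationE (R : realType) (disp : measure_display)
    (T : measurableType disp) (P : probability T R) (X : T -> R) :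
  ('E_P[X] = \int[P]_w (X w)%:E)%E.
Proof. by rewrite unlock. Qed.

Section expectation_ge0.
Context (R : realType) (disp : measure_display)
  (Omega : measurableType disp) (P : probability Omega R).
Implicit Types X Y : Omega -> R.

Lemma ge0_expectation_le X Y :
  measurable_fun setT X -> measurable_fun setT Y ->
  (forall w, 0 <= X w) -> (forall w, X w <= Y w) -> ('E_P[X] <= 'E_P[Y])%E.
Proof.
move=> mX mY X0 XY; apply: expectation_le => //.
  by move=> w; exact: le_trans (XY w).
by apply: aeW.
Qed.

Lemma ge0_expectation_affine (a b c : R) X Y :
  0 <= a -> 0 <= b -> 0 <= c ->
  measurable_fun setT X -> measurable_fun setT Y ->
  (forall w, 0 <= X w) -> (forall w, 0 <= Y w) ->
  ('E_P[fun w => (a * X w + c + b * Y w)%R]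
   = a%:E * 'E_P[X] + c%:E + b%:E * 'E_P[Y])%E.
Proof.
move=> a0 b0 c0 mX mY X0 Y0; rewrite !expectationE.
under eq_integral do rewrite !EFinD !EFinM.
have mZ (k : R) (Z : Omega -> R) : measurable_fun setT Z ->
    measurable_fun setT (fun w => k%:E * (Z w)%:E)%E.
  by move=> mZ; apply/measurable_EFinP; apply: measurable_funM.
rewrite ge0_integralD//; last 4 first.
- by move=> w _; rewrite adde_ge0 ?mule_ge0 ?lee_fin.
- by apply: emeasurable_funD => //; exact: mZ.
- by move=> w _; rewrite mule_ge0 ?lee_fin.
- exact: mZ.
rewrite ge0_integralD//; last 2 first.
- by move=> w _; rewrite mule_ge0 ?lee_fin.
- exact: mZ.
have EZ (k : R) (Z : Omega -> R) :
    0 <= k -> measurable_fun setT Z -> (forall w, 0 <= Z w) ->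
    (\int[P]_w (k%:E * (Z w)%:E) = k%:E * \int[P]_w (Z w)%:E)%E.
  move=> k0 mZ' Z0; apply: ge0_integralZl_EFin => //.
    by move=> w _; rewrite lee_fin.
  exact/measurable_EFinP.
rewrite !EZ//; congr (_ + _ + _)%E.
by have := expectation_cst P c; rewrite expectationE.
Qed.

End expectation_ge0.

(** Conditioning on [X]: for [Z] independent of [X], the law of [(X, Z)] is a
    product measure, and a bound on the inner integral over [Z] carries over. *)
Lemma ge0_le_integral_indep (R : realType) (d0 d1 d2 : measure_display)
    (Omega : measurableType d0) (P : probability Omega R)
    (T1 : measurableType d1) (T2 : measurableType d2)
    (X : {RV P >-> T1}) (Z : {RV P >-> T2}) (psi : T1 * T2 -> \bar R)
    (c : Omega -> \bar R) :
  (forall A B, measurable A -> measurable B ->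
     P (X @^-1` A `&` Z @^-1` B) = (P (X @^-1` A) * P (Z @^-1` B))%E) ->
  measurable_fun setT psi -> (forall t, 0 <= psi t)%E ->
  measurable_fun setT c ->
  (forall w, \int[distribution P Z]_z psi (X w, z) <= c w)%E ->
  (\int[P]_w psi (X w, Z w) <= \int[P]_w c w)%E.
Proof.
move=> indep mpsi psi0 mc psi_le.
have mXZ : measurable_fun setT (fun w => (X w, Z w)).
  by apply: measurable_fun_pair; exact: measurable_funPT.
pose XZ : {RV P >-> (T1 * T2)%type} :=
  HB.pack (fun w => (X w, Z w)) (isMeasurableFun.Build _ _ _ _ _ mXZ).
have mF : measurable_fun setT (fubini_F (distribution P Z) psi).
  exact: measurable_fun_fubini_tonelli_F.
have F0 y : (0 <= fubini_F (distribution P Z) psi y)%E.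
  by apply: integral_ge0 => z _.
suff -> : (\int[P]_w psi (X w, Z w)
           = \int[P]_w fubini_F (distribution P Z) psi (X w))%E.
  apply: ge0_le_integral => //; last by move=> w _; exact: psi_le.
  by have := measurableT_comp mF (measurable_funPT X).
transitivity (\int[distribution P XZ]_t psi t)%E.
  by rewrite ge0_integral_distribution.
transitivity (\int[(distribution P X \x distribution P Z)%E]_t psi t)%E.
  apply: eq_measure_integral => A mA _; apply/esym.
  exact: (product_measure_unique (m' := distribution P XZ)).
by rewrite fubini_tonelli1// ge0_integral_distribution.
Qed.

(** * The past of the algorithm *)

Section history.
Context (R : realType) (dispO disp : measure_display)
  (Omega : measurableType dispO) (Xi : measurableType disp) (d : nat).
Variables (xi : nat -> Omega -> Xi) (x g : nat -> Omega -> 'rV[R]_d).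

(** The generators of [history xi x g k]. *)
Definition history_gen (k : nat) : set (set Omega) :=
  [set A | exists j B,
         [/\ (j < k)%N, measurable B & A = xi j @^-1` B]]
      `|` [set A | exists j (i : 'I_d) B,
         [/\ (j <= k)%N, measurable B & A = (fun w => x j w ord0 i) @^-1` B]]
      `|` [set A | exists j (i : 'I_d) B,
         [/\ (j < k)%N, measurable B & A = (fun w => g j w ord0 i) @^-1` B]].

(** The sample space equipped with the sigma-algebra [history xi x g k]. *)
Definition past (k : nat) := g_sigma_algebraType (history_gen k).

Lemma random_vector_past_x k j : (j <= k)%N ->
  random_vector (x j : past k -> 'rV[R]_d).
Proof.
move=> jk i _ B mB; rewrite setTI; apply: sub_sigma_algebra.
by left; right; exists j, i, B.
Qed.

Lemma random_vector_past_g k j : (j < k)%N ->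
  random_vector (g j : past k -> 'rV[R]_d).
Proof.
move=> jk i _ B mB; rewrite setTI; apply: sub_sigma_algebra.
by right; exists j, i, B.
Qed.

Lemma measurable_past k :
  (forall j, measurable_fun setT (xi j)) ->
  (forall j, random_vector (x j)) -> (forall j, random_vector (g j)) ->
  measurable_fun setT (fun w : Omega => w : past k).
Proof.
move=> mxi mx mg _ A mA; rewrite setTI.
move: A mA; apply: smallest_sub; first exact: sigma_algebra_measurable.
by move=> A [[[j [B [_ mB ->]]]|[j [i [B [_ mB ->]]]]]|[j [i [B [_ mB ->]]]]];
  rewrite -[X in measurable X]setTI; [exact: mxi|exact: mx|exact: mg].
Qed.

End history.

(** * Moments of the deviation of a client *)

(** The deviation of the gradient of client [b] from that of the objective. *)
Definition client_dev (R : realType) (disp : measure_display)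
    (Xi : measurableType disp) (D : probability Xi R) (d : nat)
    (F : Xi -> 'rV[R]_d -> R) (b : Xi) (y : 'rV[R]_d) : 'rV[R]_d :=
  grad (F b) y - grad (objective D F) y.

Section client.
Context (R : realType) (disp : measure_display)
    (Xi : measurableType disp) (D : probability Xi R) (d : nat)
    (F : Xi -> 'rV[R]_d -> R) (sigma delta : R).
Hypothesis F_smooth : smooth_objective D F.
Hypothesis F_variance : bounded_variance D F sigma.
Hypothesis delta_ge0 : 0 <= delta.
Hypothesis F_similarity : hessian_similarity D F delta.
Local Notation f := (objective D F).
Local Notation h := (client_dev D F).

Lemma client_dev_lipschitz b y z : enorm (h b y - h b z) <= delta * enorm (y - z).
Proof.
rewrite /client_dev opprB addrA [_ + grad f z - _]addrAC.
exact: F_similarity.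
Qed.

Lemma continuous_client_dev b i : continuous (fun y => h b y ord0 i).
Proof.
move=> y; apply/(@cvgrPdist_le _ _ _ (nbhs y) _ (fun z => h b z ord0 i)) => e e0.
have [e' e'E] : exists e' : R, e' = e / ((delta + 1) * d.+1%:R).
  by eexists.
have dd0 : 0 < (delta + 1) * d.+1%:R.
  by rewrite mulr_gt0 ?ltr0n// ltr_pwDr.
have e'0 : 0 < e' by rewrite e'E divr_gt0.
have : \forall z \near y, ball y e' z by exact: nbhsx_ballx.
apply: filterS => z [_ yz].
have {}yz j : `|(y - z) ord0 j| <= e' by rewrite !mxE ltW//; exact: yz.
have yz_le : enorm (y - z) <= d.+1%:R * e'.
  rewrite -(@ler_pXn2r _ 2)// ?nnegrE ?enorm_ge0 ?mulr_ge0 ?(ltW e'0)//.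
  rewrite enorm_sqr (@le_trans _ _ (\sum_(j < d) e' ^+ 2))//.
    by apply: ler_sum => j _; rewrite -[leLHS]real_normK ?num_real// lerXn2r
      ?nnegrE ?(ltW e'0).
  rewrite sumr_const card_ord -[_ *+ d]mulr_natl (exprMn _ d.+1%:R) ler_wpM2r ?sqr_ge0//.
  by rewrite -natrX ler_nat (leq_trans (leqnSn d))// leq_pmulr.
have := normr_le_enorm (h b y - h b z) i; rewrite !mxE => /le_trans; apply.
apply: le_trans (client_dev_lipschitz _ _ _) _.
apply: le_trans (ler_wpM2l delta_ge0 yz_le) _.
have d1 : 0 < delta + 1 by rewrite ltr_pwDr.
have -> : delta * (d.+1%:R * e') = e * (delta / (delta + 1)).
  by rewrite e'E; field; rewrite (gt_eqF d1) addrC natr1 pnatr_eq0.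
by rewrite ler_piMr ?(ltW e0)// ler_pdivrMr// mul1r lerDl.
Qed.

Lemma client_devE b y i :
  h b y ord0 i = grad (F b) y ord0 i - grad f y ord0 i.
Proof. by rewrite /client_dev !mxE. Qed.

Lemma random_vector_client_dev y : random_vector (h ^~ y).
Proof.
move=> i; have /integrableP[/measurable_EFinP mF _] :=
  client_grad_integrable F_smooth y i.
have := measurable_funB mF (@measurable_cst _ _ _ _ setT (grad f y ord0 i)).
by apply: eq_measurable_fun => b _; rewrite client_devE.
Qed.

Let integral_cst1 (c : R) : (\int[D]_b (cst c b)%:E = c%:E)%E.
Proof. by rewrite -expectationE expectation_cst. Qed.

(** The inner product of the deviation with a fixed vector has mean zero. *)
Lemma client_dev_dot u y :
  D.-integrable setT (EFin \o (fun b => dot u (h b y))) /\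
  (\int[D]_b (dot u (h b y))%:E = 0)%E.
Proof.
have int i : D.-integrable setT (EFin \o (fun b => h b y ord0 i)).
  have ic : D.-integrable setT (EFin \o cst (grad f y ord0 i)).
    exact: finite_measure_integrable_cst.
  have := integrableB measurableT (client_grad_integrable F_smooth y i) ic.
  by apply: eq_integrable => // b _; rewrite /= client_devE.
have mean i : (\int[D]_b (h b y ord0 i)%:E = 0)%E.
  have ic : D.-integrable setT (EFin \o cst (grad f y ord0 i)).
    exact: finite_measure_integrable_cst.
  transitivity (\int[D]_b ((grad (F b) y ord0 i)%:E - (cst (grad f y ord0 i) b)%:E))%E.
    by apply: eq_integral => b _; rewrite client_devE.
  rewrite integralB_EFin//; last exact: client_grad_integrable.
  by rewrite integral_cst1 -expectationE grad_expectation// subee.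
have E : (fun b => (dot u (h b y))%:E)
       = (fun b => \sum_(i < d) ((u ord0 i)%:E * (h b y ord0 i)%:E))%E.
  by apply/funext => b; rewrite /dot -sumEFin.
have inti i : D.-integrable setT
    (fun b => (u ord0 i)%:E * (h b y ord0 i)%:E)%E.
  exact: (integrableZl measurableT _ (int i)).
split; first by rewrite /comp E; exact: integrable_sum.
rewrite E integral_sum// big1// => i _.
by rewrite (integralZl measurableT (int i)) [X in (_ * X)%E](mean i) mule0.
Qed.

(** One step of the error recursion with the past frozen: [u] is the previous
    error, [z] the previous iterate and [y] the current one. *)
Lemma client_dev_second_moment (p : R) u y z : 
  (\int[D]_b (enorm ((1 - p) *: u + (h b y - (1 - p) *: h b z)) ^+ 2)%:E
   <= ((1 - p) ^+ 2 * enorm u ^+ 2 + 2 * p ^+ 2 * sigma ^+ 2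
       + 2 * (1 - p) ^+ 2 * delta ^+ 2 * enorm (y - z) ^+ 2)%:E)%E.
Proof.
(* The integrand is at most c plus two centred terms, from expanding the square,
   plus [2 * p ^+ 2 * enorm (h b y) ^+ 2]. *)
set c : R := (1 - p) ^+ 2 * enorm u ^+ 2
             + 2 * (1 - p) ^+ 2 * delta ^+ 2 * enorm (y - z) ^+ 2.
pose u1 := (2 * (1 - p)) *: u; pose u2 := (- (2 * (1 - p) ^+ 2)) *: u.
have [i1 m1] := client_dev_dot u1 y; have [i2 m2] := client_dev_dot u2 z.
have mN : measurable_fun setT (fun b => enorm (h b y) ^+ 2).
  exact/measurable_enorm_sqr/random_vector_client_dev.
have N_le : (\int[D]_b (enorm (h b y) ^+ 2)%:E <= (sigma ^+ 2)%:E)%E.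
  by rewrite -expectationE; exact: F_variance.
have ic : D.-integrable setT (EFin \o cst c).
  exact: finite_measure_integrable_cst.
pose B b : R := c + dot u1 (h b y) + dot u2 (h b z).
have iB : D.-integrable setT (EFin \o B).
  have := integrableD measurableT (integrableD measurableT ic i1) i2.
  by apply: eq_integrable.
have mB : (\int[D]_b (B b)%:E = c%:E)%E.
  have i12 : D.-integrable setT (EFin \o (fun b => c + dot u1 (h b y))).
    by have := integrableD measurableT ic i1; apply: eq_integrable.
  rewrite (@integralD_EFin _ _ _ D setT measurableT
    (fun b => c + dot u1 (h b y)) (fun b => dot u2 (h b z)))// m2 adde0.
  rewrite (@integralD_EFin _ _ _ D setT measurableT
    (cst c) (fun b => dot u1 (h b y)))// m1 adde0.
  exact: integral_cst1.
have iN : D.-integrable setT (EFin \o (fun b => 2 * p ^+ 2 * enorm (h b y) ^+ 2)).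
  have : D.-integrable setT (EFin \o (fun b => enorm (h b y) ^+ 2)).
    apply/integrableP; split; first exact/measurable_EFinP.
    under eq_integral do rewrite /= ger0_norm ?sqr_ge0//.
    by apply: le_lt_trans N_le _; rewrite ltry.
  move=> /(integrableZl measurableT (2 * p ^+ 2)).
  by apply: eq_integrable.
apply: (@le_trans _ _
  (\int[D]_b (B b + 2 * p ^+ 2 * enorm (h b y) ^+ 2)%:E)%E).
  apply: ge0_le_integral => //.
  - by move=> b _; rewrite lee_fin sqr_ge0.
  - apply/measurable_EFinP/measurable_enorm_sqr.
    apply: random_vectorD; first by move=> i; exact: measurable_cst.
    apply: random_vectorB; first exact: random_vector_client_dev.
    exact/random_vectorZ/random_vector_client_dev.
  - have /integrableP[+ _] := integrableD measurableT iB iN.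
    exact: eq_measurable_fun.
  - move=> b _; rewrite lee_fin.
    set a := h b y - _.
    have -> : a = p *: h b y + (1 - p) *: (h b y - h b z).
      by apply/rowP => i; rewrite /a !mxE; ring.
    rewrite enorm_sqrD enorm_sqrZ.
    have := enorm_sqrD_le2 (p *: h b y) ((1 - p) *: (h b y - h b z)).
    rewrite !enorm_sqrZ => V_le.
    have L_le : enorm (h b y - h b z) ^+ 2 <= delta ^+ 2 * enorm (y - z) ^+ 2.
      rewrite -exprMn ler_pXn2r ?nnegrE ?mulr_ge0 ?enorm_ge0//.
      exact: client_dev_lipschitz.
    have {}L_le := ler_wpM2l (mulr_ge0 (ler0n _ 2) (sqr_ge0 (1 - p))) L_le.
    have -> : dot ((1 - p) *: u) (p *: h b y + (1 - p) *: (h b y - h b z))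
            = 2^-1 * (dot u1 (h b y) + dot u2 (h b z)).
      rewrite /u1 /u2 !dotZl dotDr !dotZr dotDr dotNr.
      by field.
    rewrite /B /c; move: V_le L_le; lra.
rewrite (@integralD_EFin _ _ _ D setT measurableT B)// mB.
under [X in (_ + X)%E]eq_integral do rewrite /= EFinM.
rewrite ge0_integralZl//; last 3 first.
- exact/measurable_EFinP.
- by move=> b _; rewrite lee_fin sqr_ge0.
- by rewrite lee_fin mulr_ge0// sqr_ge0.
apply: (@le_trans _ _ (c%:E + (2 * p ^+ 2)%:E * (sigma ^+ 2)%:E)%E).
  by rewrite leeD2l// lee_wpmul2l// lee_fin mulr_ge0// sqr_ge0.
rewrite -EFinM -EFinD lee_fin /c; lra.
Qed.

End client.

(** * Recursions for the iterates *)

Section spam.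
Context (R : realType) (dispO disp : measure_display)
    (Omega : measurableType dispO) (P : probability Omega R)
    (Xi : measurableType disp) (D : probability Xi R) (d : nat)
    (F : Xi -> 'rV[R]_d -> R) (f_inf sigma delta gamma p : R)
    (x0 g0 : 'rV[R]_d)
    (xi : nat -> {RV P >-> Xi}) (x g : nat -> Omega -> 'rV[R]_d).
Hypothesis F_smooth : smooth_objective D F.
Hypothesis f_bounded_below : forall y, f_inf <= objective D F y.
Hypothesis F_variance : bounded_variance D F sigma.
Hypothesis delta_ge0 : 0 <= delta.
Hypothesis F_similarity : hessian_similarity D F delta.
Hypothesis gamma_gt0 : 0 < gamma.
Hypothesis x_spam : SPAM D F (fun=> gamma) (fun=> p) x0 g0 xi x g.
Local Notation f := (objective D F).
Local Notation h := (client_dev D F).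

Let df : forall y, differentiable f y := objective_differentiable F_smooth.
Let mx : forall k, random_vector (x k) := spam_x_random x_spam.
Let mg : forall k, random_vector (g k) := spam_g_random x_spam.

(** The estimation error of [g k]. *)
Definition grad_error k w := g k w - grad f (x k w).
Local Notation e := grad_error.

Lemma random_vector_grad_error k : random_vector (e k).
Proof. by apply: random_vectorB => //; exact: random_vector_grad. Qed.

Lemma grad_errorS k w : e k.+1 w = (1 - p) *: e k w
  + (h (xi k.+1 w) (x k.+1 w) - (1 - p) *: h (xi k.+1 w) (x k w)).
Proof.
rewrite /e (spam_gS x_spam) /client_dev.
set u := grad _ _; set v := grad _ _; set a := grad _ _; set b := grad _ _.
by apply/rowP => i; rewrite !mxE; ring.
Qed.

(* The identity of the sample space, as a random variable generating the past. *)
Let past_id k : {RV P >-> past (fun j => xi j : Omega -> Xi) x g k} :=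
  HB.pack (fun w : Omega => w : past (fun j => xi j : Omega -> Xi) x g k)
    (isMeasurableFun.Build _ _ _ _ _
      (measurable_past (k := k) (fun j => measurable_funPT (xi j)) mx mg)).

(** The new client is independent of the past, which determines the previous
    error and both iterates, so [client_dev_second_moment] applies
    conditionally. *)
Lemma grad_error_recursion k :
  ('E_P[fun w => (enorm (e k.+1 w) ^+ 2)%R]
   <= 'E_P[fun w => ((1 - p) ^+ 2 * enorm (e k w) ^+ 2
        + 2 * p ^+ 2 * sigma ^+ 2
        + 2 * (1 - p) ^+ 2 * delta ^+ 2 * enorm (x k.+1 w - x k w) ^+ 2)%R])%E.
Proof.
rewrite !expectationE.
pose T := past (fun j => xi j : Omega -> Xi) x g k.+1.
pose v (t : T * Xi) := (1 - p) *: e k t.1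
  + (h t.2 (x k.+1 t.1) - (1 - p) *: h t.2 (x k t.1)).
have mv : random_vector v.
  have mxT j : (j <= k.+1)%N -> random_vector (x j : T -> 'rV[R]_d).
    exact: random_vector_past_x.
  have mh j : (j <= k.+1)%N -> random_vector (fun t : T * Xi => h t.2 (x j t.1)).
    move=> jk i.
    apply: (@measurable_caratheodory _ _ _ _
      (fun (t : T * Xi) y => h t.2 y ord0 i) (fun t : T * Xi => x j t.1)).
    - move=> y; apply: (measurableT_comp (f := fun b => h b y ord0 i)) => //.
      exact: random_vector_client_dev.
    - by move=> t; exact: (continuous_client_dev delta_ge0 F_similarity).
    - apply: (@random_vector_comp _ _ _ _ _ _ fst) => //.
      exact: mxT.
  apply: random_vectorD.
    apply: random_vectorZ.
    apply: (@random_vector_comp _ _ _ _ T _ fst) => //.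
    apply: random_vectorB; first exact: random_vector_past_g.
    by apply: random_vector_grad => //; exact: mxT.
  by apply: random_vectorB; [|apply: random_vectorZ]; exact: mh.
have -> : (\int[P]_w (enorm (e k.+1 w) ^+ 2)%:E =
    \int[P]_w (enorm (v (past_id k.+1 w, xi k.+1 w)) ^+ 2)%:E)%E.
  by apply: eq_integral => w _; rewrite grad_errorS.
apply: (@ge0_le_integral_indep _ _ _ _ _ _ _ _ (past_id k.+1) (xi k.+1)
   (fun t => (enorm (v t) ^+ 2)%:E)).
- by move=> A B mA mB; exact: (spam_client_indep x_spam).
- exact/measurable_EFinP/measurable_enorm_sqr.
- by move=> t; rewrite lee_fin sqr_ge0.
- apply/measurable_EFinP; apply: measurable_funD.
    apply: measurable_funD => //; apply: measurable_funM => //.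
    exact/measurable_enorm_sqr/random_vector_grad_error.
  apply: measurable_funM => //.
  exact/measurable_enorm_sqr/random_vectorB.
- move=> w.
  rewrite (@eq_measure_integral _ _ _ setT D); last first.
    by move=> B mB _; exact: (spam_client_law x_spam).
  exact: (client_dev_second_moment F_smooth F_variance delta_ge0 F_similarity
    p (e k w) (x k.+1 w) (x k w)).
Qed.

Hypothesis gamma_delta_le : 16 * delta ^+ 2 * gamma ^+ 2 <= 1.

(** The extended-real expectations entering the recursions: second moments of
    the estimation error, of the step and of the true gradient, and the mean
    suboptimality. *)
Definition error_moment k := 'E_P[fun w => (enorm (e k w) ^+ 2)%R]%E.
Definition step_moment k := 'E_P[fun w => (enorm (x k.+1 w - x k w) ^+ 2)%R]%E.
Definition mean_gap k := 'E_P[fun w => (f (x k w) - f_inf)%R]%E.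
Definition grad_moment k := 'E_P[fun w => (enorm (grad f (x k w)) ^+ 2)%R]%E.

Let m_error k : measurable_fun setT (fun w => enorm (e k w) ^+ 2).
Proof. exact/measurable_enorm_sqr/random_vector_grad_error. Qed.

Let m_step k : measurable_fun setT (fun w => enorm (x k.+1 w - x k w) ^+ 2).
Proof. exact/measurable_enorm_sqr/random_vectorB. Qed.

Let m_gap k : measurable_fun setT (fun w => f (x k w) - f_inf).
Proof.
apply: measurable_funB => //; apply: measurable_continuous_comp => // y.
exact: differentiable_continuous.
Qed.

Let m_grad k : measurable_fun setT (fun w => enorm (grad f (x k w)) ^+ 2).
Proof. exact/measurable_enorm_sqr/random_vector_grad. Qed.

Let gap_ge0 k w : 0 <= f (x k w) - f_inf.
Proof. by rewrite subr_ge0. Qed.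

Lemma error_moment_le k :
  (error_moment k.+1 <= ((1 - p) ^+ 2)%:E * error_moment k
     + (2 * p ^+ 2 * sigma ^+ 2)%:E
     + (2 * (1 - p) ^+ 2 * delta ^+ 2)%:E * step_moment k)%E.
Proof.
apply: le_trans (grad_error_recursion k) _.
have c2 (a b : R) : 0 <= 2 * a ^+ 2 * b ^+ 2.
  exact: mulr_ge0 (mulr_ge0 (ler0n _ 2) (sqr_ge0 _)) (sqr_ge0 _).
rewrite (ge0_expectation_affine P (sqr_ge0 (1 - p)) (c2 _ _) (c2 _ _)
  (m_error k) (m_step k))// => w; exact: sqr_ge0.
Qed.

Lemma mean_gap_le k :
  (mean_gap k.+1 + ((6 * gamma)^-1)%:E * step_moment k
   <= mean_gap k + (6 / 5 * gamma)%:E * error_moment k)%E.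
Proof.
have c1 : 0 <= (6 * gamma)^-1 by rewrite invr_ge0 mulr_ge0// ltW.
have c2 : 0 <= 6 / 5 * gamma by rewrite mulr_ge0 ?divr_ge0// ltW.
have s0 k' w : 0 <= enorm (x k'.+1 w - x k' w) ^+ 2 by exact: sqr_ge0.
have e0 k' w : 0 <= enorm (e k' w) ^+ 2 by exact: sqr_ge0.
have L := ge0_expectation_affine P ler01 c1 (lexx 0) (m_gap k.+1) (m_step k)
  (gap_ge0 k.+1) (s0 k).
have U := ge0_expectation_affine P ler01 c2 (lexx 0) (m_gap k) (m_error k)
  (gap_ge0 k) (e0 k).
rewrite !mul1e !adde0 in L U; rewrite /mean_gap /step_moment /error_moment -L -U.
apply: ge0_expectation_le.
- apply: measurable_funD; last exact: measurable_funM.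
  by apply: measurable_funD => //; exact: measurable_funM.
- apply: measurable_funD; last exact: measurable_funM.
  by apply: measurable_funD => //; exact: measurable_funM.
- by move=> w; rewrite !mul1r addr0 addr_ge0// mulr_ge0.
move=> w; have := prox_descent (client_differentiable F_smooth (xi k w)) df
  delta_ge0 (F_similarity (xi k w)) gamma_gt0 gamma_delta_le (spam_xS x_spam k w).
by rewrite /e; lra.
Qed.

Lemma grad_moment_le k :
  (grad_moment k.+1
   <= 2%:E * error_moment k + (25 / (8 * gamma ^+ 2))%:E * step_moment k)%E.
Proof.
have c1 : 0 <= 25 / (8 * gamma ^+ 2) by rewrite divr_ge0// mulr_ge0// sqr_ge0.
have s0 k' w : 0 <= enorm (x k'.+1 w - x k' w) ^+ 2 by exact: sqr_ge0.
have e0 k' w : 0 <= enorm (e k' w) ^+ 2 by exact: sqr_ge0.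
have U := ge0_expectation_affine P (ler0n _ 2) c1 (lexx 0) (m_error k) (m_step k)
  (e0 k) (s0 k).
rewrite adde0 in U; rewrite /grad_moment /step_moment /error_moment -U.
apply: ge0_expectation_le.
- exact: m_grad.
- apply: measurable_funD; last exact: measurable_funM.
  by apply: measurable_funD => //; exact: measurable_funM.
- by move=> w; rewrite sqr_ge0.
move=> w; rewrite addr0.
exact: (prox_grad_le (client_differentiable F_smooth (xi k w)) delta_ge0
  (F_similarity (xi k w)) gamma_gt0 gamma_delta_le (spam_xS x_spam k w)).
Qed.

Lemma error_moment_ge0 k : (0 <= error_moment k)%E.
Proof. by apply: expectation_ge0 => w; rewrite sqr_ge0. Qed.

Lemma step_moment_ge0 k : (0 <= step_moment k)%E.
Proof. by apply: expectation_ge0 => w; rewrite sqr_ge0. Qed.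

Lemma mean_gap_ge0 k : (0 <= mean_gap k)%E.
Proof. exact: expectation_ge0. Qed.

Lemma grad_moment_ge0 k : (0 <= grad_moment k)%E.
Proof. by apply: expectation_ge0 => w; rewrite sqr_ge0. Qed.

Lemma error_moment0 : error_moment 0 = (enorm (g0 - grad f x0) ^+ 2)%:E.
Proof.
rewrite /error_moment -(expectation_cst P); congr expectation.
by apply/funext => w; rewrite /e (spam_g0 x_spam) (spam_x0 x_spam).
Qed.

Lemma mean_gap0 : mean_gap 0 = (f x0 - f_inf)%:E.
Proof.
rewrite /mean_gap -(expectation_cst P); congr expectation.
by apply/funext => w; rewrite (spam_x0 x_spam).
Qed.

Lemma step_moment_fin k : mean_gap k \is a fin_num ->
  error_moment k \is a fin_num -> step_moment k \is a fin_num.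
Proof.
move=> gap_fin error_fin.
have : (((6 * gamma)^-1)%:E * step_moment k < +oo)%E.
  apply: le_lt_trans (le_trans _ (mean_gap_le k)) _.
    by rewrite leeDr// mean_gap_ge0.
  by rewrite ltey_eq fin_numD gap_fin fin_numM.
rewrite (ge0_fin_numE (step_moment_ge0 k)).
have := step_moment_ge0 k; case: (step_moment k) => [r| |]// _.
  by move=> _; rewrite ltry.
by rewrite mulry gtr0_sg ?mul1e ?ltxx// invr_gt0 mulr_gt0.
Qed.

(** Nothing is assumed about the integrability of the iterates: finiteness
    propagates from the deterministic starting point. *)
Lemma moments_fin k :
  mean_gap k \is a fin_num /\ error_moment k \is a fin_num.
Proof.
elim: k => [|k [gap_fin error_fin]]; first by rewrite mean_gap0 error_moment0.
have step_fin := step_moment_fin gap_fin error_fin.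
split.
  rewrite ge0_fin_numE ?mean_gap_ge0//.
  apply: le_lt_trans (le_trans _ (mean_gap_le k)) _.
    rewrite leeDl// mule_ge0 ?step_moment_ge0// lee_fin invr_ge0 mulr_ge0//.
    exact: ltW.
  by rewrite ltey_eq fin_numD gap_fin fin_numM.
rewrite ge0_fin_numE ?error_moment_ge0//.
apply: le_lt_trans (error_moment_le k) _.
by rewrite ltey_eq !fin_numD !fin_numM.
Qed.

Lemma grad_moment_fin k : grad_moment k.+1 \is a fin_num.
Proof.
have [gap_fin error_fin] := moments_fin k.
rewrite ge0_fin_numE ?grad_moment_ge0//.
apply: le_lt_trans (grad_moment_le k) _.
by rewrite ltey_eq fin_numD !fin_numM//; exact: step_moment_fin.
Qed.

Lemma spam_average_bound (K : nat) : 0 < p <= 1 ->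
  96 * delta ^+ 2 * (1 - p) * gamma ^+ 2 <= p -> (1 <= K)%N ->
  ((K%:R^-1)%:E * \sum_(1 <= k < K.+1) grad_moment k
   <= (32 * (f x0 - f_inf) / (gamma * K%:R)
       + 32 * enorm (g0 - grad f x0) ^+ 2 / ((2 * p - p ^+ 2) * K%:R)
       + 64 * p * sigma ^+ 2)%R%:E)%E.
Proof.
move=> p01 gp K1.
have gapE k : mean_gap k = (fine (mean_gap k))%:E.
  by rewrite fineK//; case: (moments_fin k).
have errorE k : error_moment k = (fine (error_moment k))%:E.
  by rewrite fineK//; case: (moments_fin k).
have stepE k : step_moment k = (fine (step_moment k))%:E.
  by rewrite fineK//; apply: step_moment_fin; case: (moments_fin k).
have gradE k : grad_moment k.+1 = (fine (grad_moment k.+1))%:E.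
  by rewrite fineK// grad_moment_fin.
have -> : (\sum_(1 <= k < K.+1) grad_moment k
           = (\sum_(1 <= k < K.+1) fine (grad_moment k))%:E)%E.
  rewrite -sumEFin; apply: eq_big_nat => -[//|k] _; exact: gradE.
rewrite -EFinM lee_fin.
have := @recursion_bound _ (fine \o mean_gap) (fine \o error_moment)
  (fine \o step_moment) (fine \o grad_moment) delta gamma p sigma K.
rewrite /= mean_gap0 error_moment0 /=; apply => //.
- by move=> k; rewrite fine_ge0 ?mean_gap_ge0.
- by move=> k; rewrite fine_ge0 ?error_moment_ge0.
- by move=> k; rewrite fine_ge0 ?step_moment_ge0.
- move=> k; have := mean_gap_le k.
  by rewrite gapE errorE stepE (gapE k) -!EFinM -!EFinD lee_fin.
- move=> k; have := error_moment_le k.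
  by rewrite errorE stepE (errorE k) -!EFinM -!EFinD lee_fin.
- move=> k; have := grad_moment_le k.
  by rewrite gradE errorE stepE -!EFinM -!EFinD lee_fin.
Qed.

End spam.

(** Each part of the stepsize condition in polynomial form: when [s = 0] the
    quotient is infinite and the conclusion reads [0 <= c]. *)
Lemma stepsize_le (R : realType) (t c s : R) : 0 <= s ->
  (t%:E <= c%:E / s%:E)%E -> 0 < c -> s * t <= c.
Proof.
move=> s0 + c0; rewrite inver; case: eqP => [->|/eqP s_neq0].
  by rewrite mul0r (ltW c0).
have {}s0 : 0 < s by rewrite lt_def s_neq0.
by rewrite -EFinM lee_fin ler_pdivlMr// mulrC.
Qed.

Theorem theorem3p2 (R : realType) (dispO disp : measure_display)
    (Omega : measurableType dispO) (P : probability Omega R)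
    (Xi : measurableType disp) (D : probability Xi R) (d : nat)
    (F : Xi -> 'rV[R]_d -> R) (f_inf sigma delta gamma p : R)
    (x0 g0 : 'rV[R]_d)
    (xi : nat -> {RV P >-> Xi}) (x g : nat -> Omega -> 'rV[R]_d)
    (F_smooth : smooth_objective D F)
    (f_bounded_below : forall y, f_inf <= objective D F y)
    (sigma_ge0 : 0 <= sigma)
    (F_variance : bounded_variance D F sigma)
    (delta_ge0 : 0 <= delta)
    (F_similarity : hessian_similarity D F delta)
    (gamma_gt0 : 0 < gamma)
    (p_gt0 : 0 < p) (p_le1 : p <= 1)
    (gamma_le : ((gamma ^+ 2)%:E
       <= mine (1 / (16 * delta ^+ 2)%:E)
               (p%:E / (96 * delta ^+ 2 * (1 - p))%:E))%E)
    (x_spam : SPAM D F (fun=> gamma) (fun=> p) x0 g0 xi x g)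
    (K : nat) (K_ge1 : (1 <= K)%N) :
  ((K%:R^-1)%:E
     * \sum_(1 <= k < K.+1) 'E_P[fun w => (enorm (grad (objective D F) (x k w)) ^+ 2)%R]
   <= (32 * (objective D F x0 - f_inf) / (gamma * K%:R)
       + 32 * enorm (g0 - grad (objective D F) x0) ^+ 2
           / ((2 * p - p ^+ 2) * K%:R)
       + 64 * p * sigma ^+ 2)%R%:E)%E.
Proof.
have [gamma_le1 gamma_le2] : ((gamma ^+ 2)%:E <= 1 / (16 * delta ^+ 2)%:E)%E /\
    ((gamma ^+ 2)%:E <= p%:E / (96 * delta ^+ 2 * (1 - p))%:E)%E.
  by move: gamma_le; rewrite le_min => /andP.
apply: (spam_average_bound F_smooth f_bounded_below F_variance delta_ge0
  F_similarity gamma_gt0 x_spam) => //.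
- by apply: stepsize_le => //; rewrite mulr_ge0// sqr_ge0.
- by rewrite p_gt0.
- by apply: stepsize_le => //; rewrite mulr_ge0 ?subr_ge0// mulr_ge0// sqr_ge0.
Qed.
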